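(* Let $x_0$ be an optimal solution of the problem $\min_{x\in\mathbb{R}^n}\|x\|_{1,2}$ subject to $\Phi x=y_0$. Let $v\in\partial\|\cdot\|_{1,2}(x_0)\cap\operatorname{Im}\Phi^*$ and let $\mathcal{K}=\{J\in\mathcal{I}^c\mid\|v_J\|=1\}$. Stable recovery occurs at $x_0$ if the following two conditions hold: $$W(x_0)\cap\mathcal{E}=\{0\}\qquad\text{and}\qquad\begin{cases}z\in\Phi_{\mathcal{K}}^*(\operatorname{Ker}\Phi_{\mathcal{I}}^* )\\ \langle z_J,v_J\rangle\ge0,\ J\in\mathcal{K}\end{cases}\ \Longrightarrow\ z=0.$$
   Context: Setting: $\mathcal{J}$ is a partition of $\{1,\dots,n\}$ into $q$ groups; for $x\in\mathbb{R}^n$, $\|x\|_{1,2}=\sum_{J\in\mathcal{J}}\|x_J\|$, where $x_J\in\mathbb{R}^{|J|}$ is the subvector with indices in $J$ and $\|\cdot\|$ is the Euclidean norm. $\Phi$ is a real $m\times n$ matrix, $\Phi^*$ its transpose, $y_0\in\mathbb{R}^m$. For $\mathcal{L}\subset\mathcal{J}$: $\mathbb{R}^{\mathcal{L}}$ is the set of tuples $w=(w_J)_{J\in\mathcal{L}}$, $w_J\in\mathbb{R}^{|J|}$; $\Phi_{\mathcal{L}}$ is the submatrix of columns of $\Phi$ with indices in the groups of $\mathcal{L}$, and $\Phi_{\mathcal{L}}^*:\mathbb{R}^m\to\mathbb{R}^{\mathcal{L}}$ its transpose, so $\Phi_{\mathcal{L}}^*u=((\Phi^*u)_J)_{J\in\mathcal{L}}$.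 Let $\mathcal{I}=\{J\in\mathcal{J}\mid(x_0)_J\ne0\}$, $\mathcal{I}^c=\mathcal{J}\setminus\mathcal{I}$, and $e_J=(x_0)_J/\|(x_0)_J\|$ for $J\in\mathcal{I}$. Then $\partial\|\cdot\|_{1,2}(x_0)=\{z\in\mathbb{R}^n\mid z_J=e_J\ \forall J\in\mathcal{I},\ \|z_J\|\le1\ \forall J\in\mathcal{I}^c\}$. $W(x_0)=\{w\in\operatorname{Ker}\Phi\mid\sum_{J\in\mathcal{I}}\langle e_J,w_J\rangle+\sum_{J\in\mathcal{I}^c}\|w_J\|=0\}$ and $\mathcal{E}=\{w\in\mathbb{R}^n\mid w_J\in\mathbb{R}(x_0)_J,\ J\in\mathcal{I}\}$. Stable recovery at $x_0$: for $y\in\mathbb{R}^m$, $\mu>0$ let $P(y,\mu)$ be the problem $\min_{x\in\mathbb{R}^n}\frac12\|\Phi x-y\|^2+\mu\|x\|_{1,2}$. Stable recovery occurs at $x_0$ if for every constant $c>0$ there exist $K>0$ and $\bar\delta>0$ such that for all $\delta\in(0,\bar\delta)$, all $y$ with $\|y-y_0\|\le\delta$, and $\mu=c\delta$, every optimal solution $x(y,\mu)$ of $P(y,\mu)$ satisfies $\|x(y,\mu)-x_0\|\le K\delta$. *)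

(* Defs.v *)
From HB Require Import structures.
From mathcomp Require Import all_boot all_order all_algebra.
From mathcomp Require Import boolp classical_sets reals.

Set Implicit Arguments.
Unset Strict Implicit.
Unset Printing Implicit Defensive.

Import Order.TTheory GRing.Theory Num.Theory.
Local Open Scope ring_scope.
Local Open Scope classical_set_scope.

Definition inner (R : realType) (k : nat) (u w : 'cV[R]_k) : R :=
  \sum_(i < k) u i 0 * w i 0.

(* The Euclidean norm; the norm `|u| that MathComp-Analysis puts on matrices is
   the sup norm. *)
Definition norm2 (R : realType) (k : nat) (u : 'cV[R]_k) : R :=
  Num.sqrt (inner u u).

(* x_J, the coordinates of x in J listed in increasing order. *)
Definition subvec (R : realType) (n : nat) (J : {set 'I_n}) (x : 'cV[R]_n) :
    'cV[R]_#|J| :=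
  \col_(k < #|J|) x (enum_val k) 0.

Definition norm12 (R : realType) (n : nat) (JJ : {set {set 'I_n}})
    (x : 'cV[R]_n) : R :=
  \sum_(J in JJ) norm2 (subvec J x).

Definition minimizer (R : realType) (T : Type) (f : T -> R) (D : set T) (x : T) :
    Prop :=
  D x /\ forall x', D x' -> f x <= f x'.

Definition subdifferential (R : realType) (n : nat) (f : 'cV[R]_n -> R)
    (x : 'cV[R]_n) : set 'cV[R]_n :=
  [set z | forall x', f x + inner z (x' - x) <= f x'].

Definition kernel (R : realType) (m n : nat) (Phi : 'M[R]_(m, n)) :
    set 'cV[R]_n :=
  [set w | Phi *m w = 0].

(* I, the groups on which x0 does not vanish, and its complement in JJ. *)
Definition active (R : realType) (n : nat) (JJ : {set {set 'I_n}})
    (x0 : 'cV[R]_n) : {set {set 'I_n}} :=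
  [set J in JJ | subvec J x0 != 0]%SET.

Definition inactive (R : realType) (n : nat) (JJ : {set {set 'I_n}})
    (x0 : 'cV[R]_n) : {set {set 'I_n}} :=
  JJ :\: active JJ x0.

(* e_J; only used for J in active JJ x0. *)
Definition direction (R : realType) (n : nat) (x0 : 'cV[R]_n) (J : {set 'I_n}) :
    'cV[R]_#|J| :=
  (norm2 (subvec J x0))^-1 *: subvec J x0.

Definition saturated (R : realType) (n : nat) (JJ : {set {set 'I_n}})
    (x0 v : 'cV[R]_n) : {set {set 'I_n}} :=
  [set J in inactive JJ x0 | norm2 (subvec J v) == 1]%SET.

Definition Wset (R : realType) (m n : nat) (JJ : {set {set 'I_n}})
    (Phi : 'M[R]_(m, n)) (x0 : 'cV[R]_n) : set 'cV[R]_n :=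
  [set w | kernel Phi w /\
    \sum_(J in active JJ x0) inner (direction x0 J) (subvec J w)
    + \sum_(J in inactive JJ x0) norm2 (subvec J w) = 0].

Definition Eset (R : realType) (n : nat) (JJ : {set {set 'I_n}})
    (x0 : 'cV[R]_n) : set 'cV[R]_n :=
  [set w | forall J, J \in active JJ x0 ->
    exists t : R, subvec J w = t *: subvec J x0].

(* The space R^L of tuples (w_J), J in L. *)
Definition blockvec (R : realType) (n : nat) (L : {set {set 'I_n}}) : Type :=
  forall J : {J : {set 'I_n} | J \in L}, 'cV[R]_#|val J|.

Definition blockvec0 (R : realType) (n : nat) (L : {set {set 'I_n}}) :
    blockvec R L :=
  fun J => 0.
Arguments blockvec0 R {n} L.

Definition colblock (R : realType) (m n : nat) (Phi : 'M[R]_(m, n))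
    (J : {set 'I_n}) : 'M[R]_(m, #|J|) :=
  \matrix_(i < m, k < #|J|) Phi i (enum_val k).

(* The transpose R^m -> R^L of the submatrix of Phi with columns in the groups
   of L, computed group by group. *)
Definition trblocks (R : realType) (m n : nat) (Phi : 'M[R]_(m, n))
    (L : {set {set 'I_n}}) (u : 'cV[R]_m) : blockvec R L :=
  fun J => (colblock Phi (val J))^T *m u.
Arguments trblocks {R m n} Phi L u.

Definition ker_trblocks (R : realType) (m n : nat) (Phi : 'M[R]_(m, n))
    (L : {set {set 'I_n}}) : set 'cV[R]_m :=
  [set u | trblocks Phi L u = blockvec0 R L].

Definition penalized (R : realType) (m n : nat) (JJ : {set {set 'I_n}})
    (Phi : 'M[R]_(m, n)) (y : 'cV[R]_m) (mu : R) (x : 'cV[R]_n) : R :=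
  2^-1 * norm2 (Phi *m x - y) ^+ 2 + mu * norm12 JJ x.

Definition stable_recovery (R : realType) (m n : nat) (JJ : {set {set 'I_n}})
    (Phi : 'M[R]_(m, n)) (y0 : 'cV[R]_m) (x0 : 'cV[R]_n) : Prop :=
  forall c : R, 0 < c ->
  exists K dbar : R, [/\ 0 < K, 0 < dbar &
    forall (delta : R) (y : 'cV[R]_m) (x : 'cV[R]_n),
      0 < delta < dbar ->
      norm2 (y - y0) <= delta ->
      minimizer (penalized JJ Phi y (c * delta)) [set: 'cV[R]_n] x ->
      norm2 (x - x0) <= K * delta].

(* Main.v *)
Require Import Defs.
From HB Require Import structures.
From mathcomp Require Import all_boot all_order all_algebra.
From mathcomp Require Import boolp classical_sets reals.
From mathcomp Require Import topology normedtype derive ring lra.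

(** Write <a, b>_J and |a|_J for the inner product and Euclidean norm of the
    coordinates in a group J, h = x - x0 for the error of a solution x of the
    penalized problem, v = Phi^T u0 for the given dual certificate, and
    gap_J(x) = |x|_J - <v, x>_J, which is nonnegative because |v|_J <= 1 and
    vanishes at x0.

    Comparing the energies of x and x0 gives the usual first-order estimates:
    |Phi h| and the sum of the gaps are O(delta) (residual_and_gap_bound).
    These do not bound h by themselves.  On an active group the gap controls
    only the square of the part of h_J orthogonal to v_J, so that part is so
    far only O(sqrt delta).

    The condition on W and E says precisely that the sublinear function
    |Phi w| + sum over active J of |w - <v, w>_J v|_J
            + sum over inactive J of gap_J(w)
    vanishes only at 0: its zeros are the kernel vectors that are colinear to x0
    on the active groups and for which <v, w>_J = |w|_J elsewhere.  By
    compactness of the sphere it dominates a multiple of |w|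
    (kernel_coercive), so that only the orthogonal parts on active groups
    remain to be estimated.

    For these the optimality condition supplies a second dual vector
    s = Phi^T u in the subdifferential at x.  Three observations finish the
    argument.
    - On active groups the subgradient is calm: |s - v|_J <= 2 |h|_J / |x0|_J.
    - On saturated groups <s - v, v>_J <= 0, since |s|_J <= 1 = |v|_J.  If
      s - v vanished on the active groups, the second condition applied to its
      opposite would force it to vanish on the saturated groups too; again by
      compactness, s - v agrees on the active and saturated groups with
      some Phi^T u' such that |u'| = O(|h|) (dual_calm).
    - The products <s - v, h>_J are nonnegative and dominate gap_J(x)
      (gap_le_monotone).  Their sum over active and saturated groups is
      <u', Phi h> minus the products <Phi^T u', h>_J over the other inactive
      groups, where |h|_J = O(delta) because |v|_J < 1 there.  Hence it is
      O(|h| delta) (active_gap_calm).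
    So the orthogonal part of h_J is O(sqrt (|h| delta)) on active groups,
    coercivity gives a |h| <= O(delta) + O(sqrt (|h| delta)), and therefore
    |h| = O(delta). *)

Set Implicit Arguments.
Unset Strict Implicit.
Unset Printing Implicit Defensive.

Import Order.TTheory GRing.Theory Num.Theory.
Import numFieldNormedType.Exports.
Local Open Scope ring_scope.
Local Open Scope classical_set_scope.

(** * Inner products and norms on a set of coordinates *)

Section BlockProduct.
Variables (R : realType) (k : nat).
Implicit Types (A : {set 'I_k}) (x y z : 'cV[R]_k).

(** Restricting to the coordinates in [A] while staying in the ambient space
    avoids the column vectors of varying size [#|J|]; [inner_subvec] and
    [norm2_subvec] translate back. *)
Definition dot_on A x y : R := \sum_(i in A) x i 0 * y i 0.
Definition norm_on A x : R := Num.sqrt (dot_on A x x).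

Lemma dot_onC A x y : dot_on A x y = dot_on A y x.
Proof. by apply: eq_bigr => i _; rewrite mulrC. Qed.

Lemma dot_onDl A x y z : dot_on A (x + y) z = dot_on A x z + dot_on A y z.
Proof. by rewrite -big_split; apply: eq_bigr => i _; rewrite mxE mulrDl. Qed.

Lemma dot_onZl A a x y : dot_on A (a *: x) y = a * dot_on A x y.
Proof. by rewrite mulr_sumr; apply: eq_bigr => i _; rewrite mxE mulrA. Qed.

Lemma dot_onDr A x y z : dot_on A z (x + y) = dot_on A z x + dot_on A z y.
Proof. by rewrite !(dot_onC _ z) dot_onDl. Qed.

Lemma dot_onZr A a x y : dot_on A y (a *: x) = a * dot_on A y x.
Proof. by rewrite !(dot_onC _ y) dot_onZl. Qed.

Lemma dot_onNl A x y : dot_on A (- x) y = - dot_on A x y.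
Proof. by rewrite -scaleN1r dot_onZl mulN1r. Qed.

Lemma dot_onNr A x y : dot_on A x (- y) = - dot_on A x y.
Proof. by rewrite dot_onC dot_onNl dot_onC. Qed.

Definition dot_onE :=
  (dot_onDl, dot_onDr, dot_onNl, dot_onNr, dot_onZl, dot_onZr).

Lemma eq_dot_on A x x' y y' : (forall i, i \in A -> x i 0 = x' i 0) ->
  (forall i, i \in A -> y i 0 = y' i 0) -> dot_on A x y = dot_on A x' y'.
Proof. by move=> xx' yy'; apply: eq_bigr => i iA; rewrite xx' ?yy'. Qed.

Lemma dot_on_ge0 A x : 0 <= dot_on A x x.
Proof. by apply: sumr_ge0 => i _; rewrite -expr2 sqr_ge0. Qed.

Lemma norm_on_ge0 A x : 0 <= norm_on A x.
Proof. exact: sqrtr_ge0. Qed.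

Lemma norm_on_sqr A x : norm_on A x ^+ 2 = dot_on A x x.
Proof. by rewrite sqr_sqrtr ?dot_on_ge0. Qed.

Lemma norm_on_eq0 A x : norm_on A x = 0 -> forall i, i \in A -> x i 0 = 0.
Proof.
move=> x0; have : dot_on A x x = 0 by rewrite -norm_on_sqr x0 expr0n.
move/psumr_eq0P => H i iA; apply/eqP; rewrite -[_ == _]orbb -mulf_eq0.
by rewrite H// => j _; rewrite -expr2 sqr_ge0.
Qed.

(** Cauchy-Schwarz: expand the square of [b *: x - a *: y] for the norms [a] of
    [x] and [b] of [y]. *)
Lemma dot_on_le A x y : dot_on A x y <= norm_on A x * norm_on A y.
Proof.
set a := norm_on A x; set b := norm_on A y.
have a0 : 0 <= a by exact: norm_on_ge0.
have b0 : 0 <= b by exact: norm_on_ge0.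
have [ab|] := ltP 0 (a * b).
  have := dot_on_ge0 A (b *: x - a *: y).
  rewrite !dot_onE -!norm_on_sqr -/a -/b (dot_onC _ y x) => H.
  rewrite -(ler_pM2l ab); nra.
move=> ab; have /eqP : a * b = 0 by apply/le_anti; rewrite ab mulr_ge0.
rewrite mulf_eq0 /dot_on => /orP[] /eqP/norm_on_eq0 z0;
  rewrite big1 ?mulr_ge0//.
  by move=> i iA; rewrite z0 ?mul0r.
by move=> i iA; rewrite z0 ?mulr0.
Qed.

Lemma ler_norm_onD A x y : norm_on A (x + y) <= norm_on A x + norm_on A y.
Proof.
rewrite -(@ler_pXn2r _ 2) ?nnegrE ?addr_ge0 ?norm_on_ge0//.
rewrite norm_on_sqr !dot_onE sqrrD !norm_on_sqr (dot_onC _ y x).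
have := dot_on_le A x y; lra.
Qed.

Lemma norm_onN A x : norm_on A (- x) = norm_on A x.
Proof. by rewrite /norm_on !dot_onE opprK. Qed.

Lemma norm_onZ A a x : norm_on A (a *: x) = `|a| * norm_on A x.
Proof.
by rewrite /norm_on !dot_onE mulrA -expr2 sqrtrM ?sqr_ge0// sqrtr_sqr.
Qed.

Lemma norm_onS A (B : {set 'I_k}) x : A \subset B -> norm_on A x <= norm_on B x.
Proof.
move=> AB; rewrite ler_wsqrtr// /dot_on [leRHS](big_setID A)/=.
rewrite (finset.setIidPr AB).
by rewrite lerDl sumr_ge0// => i _; rewrite -expr2 sqr_ge0.
Qed.

Lemma inner_subvec A x y : inner (subvec A x) (subvec A y) = dot_on A x y.
Proof.
by rewrite /dot_on big_enum_val; apply: eq_bigr => i _; rewrite !mxE.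
Qed.

Lemma norm2_subvec A x : norm2 (subvec A x) = norm_on A x.
Proof. by rewrite /norm2 inner_subvec. Qed.

Lemma inner_setT x y : inner x y = dot_on [set: 'I_k]%SET x y.
Proof. by apply: eq_bigl => i; rewrite inE. Qed.

Lemma norm2_setT x : norm2 x = norm_on [set: 'I_k]%SET x.
Proof. by rewrite /norm2 inner_setT. Qed.

Lemma subvec_eq0 A x : subvec A x = 0 <-> (forall i, i \in A -> x i 0 = 0).
Proof.
split=> [x0 i iA|x0]; last by apply/matrixP => i j; rewrite !mxE x0 ?enum_valP.
by move/matrixP/(_ (enum_rank_in iA i) 0): x0; rewrite !mxE enum_rankK_in.
Qed.

End BlockProduct.

(** * Sublinear functions and coercivity *)

Section Sublinear.
Variables (R : realType) (k : nat).
Implicit Types (f g : 'cV[R]_k -> R) (A : {set 'I_k}).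

Definition sublinear f := (forall x y, f (x + y) <= f x + f y) /\
  (forall a x, 0 <= a -> f (a *: x) = a * f x).

Lemma sublinear_add f g : sublinear f -> sublinear g ->
  sublinear (fun x => f x + g x).
Proof.
move=> [fD fZ] [gD gZ]; split=> [x y|a x a0]; last by rewrite fZ// gZ// mulrDr.
by rewrite addrACA lerD.
Qed.

Lemma sublinear_sum (I : finType) (P : pred I) (f : I -> 'cV[R]_k -> R) :
  (forall i, P i -> sublinear (f i)) ->
  sublinear (fun x => \sum_(i | P i) f i x).
Proof.
move=> Hf; split=> [x y|a x a0].
  by rewrite -big_split ler_sum//= => i /Hf[+ _]; apply.
by rewrite mulr_sumr; apply: eq_bigr => i /Hf[_]; apply.
Qed.

Lemma sublinear_pos f : sublinear f -> sublinear (fun x => Num.max 0 (f x)).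
Proof.
move=> [fD fZ]; split=> [x y|a x a0]; last by rewrite fZ// maxr_pMr// mulr0.
rewrite ge_max addr_ge0 ?le_max ?lexx//=; apply: le_trans (fD x y) _.
by rewrite lerD// le_max lexx orbT.
Qed.

Lemma sublinear_dot_on n (L : 'cV[R]_k -> 'cV[R]_n) (B : {set 'I_n}) z :
  linear L -> sublinear (fun x => dot_on B (L x) z).
Proof.
move=> linL; split=> [x y|a x a0].
  by rewrite -{1}[x]scale1r linL scale1r dot_onDl.
have L0 : L 0 = 0 by have := linL (-1) 0 0; rewrite !scaleN1r oppr0 addr0 addNr.
by rewrite -[_ *: x]addr0 linL L0 addr0 dot_onZl.
Qed.

Lemma sublinear_norm_on n (L : 'cV[R]_k -> 'cV[R]_n) (B : {set 'I_n}) :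
  linear L -> sublinear (fun x => norm_on B (L x)).
Proof.
move=> linL; split=> [x y|a x a0].
  by rewrite -{1}[x]scale1r linL scale1r ler_norm_onD.
have L0 : L 0 = 0 by have := linL (-1) 0 0; rewrite !scaleN1r oppr0 addr0 addNr.
by rewrite -[_ *: x]addr0 linL L0 addr0 norm_onZ ger0_norm.
Qed.

(** Decomposing along the canonical basis: only the values at the vectors of the
    basis and at their opposites matter. *)
Lemma sublinear_le_coord f : sublinear f ->
  exists2 C, 0 <= C &
    forall (x : 'cV[R]_k) N, (forall i, `|x i 0| <= N) -> f x <= C * N.
Proof.
move=> [fD fZ].
have f0 : f 0 = 0 by have := fZ 0 0 (lexx _); rewrite scale0r mul0r.
pose c i := Num.max 0 (Num.max (f (delta_mx i 0)) (f (- delta_mx i 0))).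
exists (\sum_i c i) => [|x N xN].
  by apply: sumr_ge0 => i _; rewrite le_max lexx.
have xE : x = \sum_i x i 0 *: delta_mx i 0.
  by rewrite {1}[x]matrix_sum_delta; apply: eq_bigr => i _; rewrite big_ord1.
apply: (@le_trans _ _ (\sum_i f (x i 0 *: delta_mx i 0))).
  rewrite {1}xE; elim/big_ind2: _ => [|u a w b ua wb|//]; first by rewrite f0.
  by apply: le_trans (fD _ _) _; rewrite lerD.
rewrite mulr_suml; apply: ler_sum => i _.
have ci0 : 0 <= c i by rewrite le_max lexx.
apply: le_trans (ler_wpM2l ci0 (xN i)); rewrite mulrC.
have [xi0|xi0] := leP 0 (x i 0).
  by rewrite fZ// ger0_norm// ler_wpM2l// !le_max lexx !orbT.
have -> : x i 0 *: delta_mx i 0 = (- x i 0) *: (- delta_mx i 0 : 'cV[R]_k).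
  by rewrite scaleNr scalerN opprK.
have nxi0 : 0 <= - x i 0 by rewrite oppr_ge0 ltW.
by rewrite fZ// ltr0_norm// ler_wpM2l// !le_max lexx !orbT.
Qed.

Lemma sublinear_le_norm2 f : sublinear f ->
  exists2 C, 0 <= C & forall x : 'cV[R]_k, f x <= C * norm2 x.
Proof.
move=> /sublinear_le_coord[C C0 fC]; exists C => // x; apply: fC => i.
rewrite norm2_setT -sqrtr_sqr ler_wsqrtr// /dot_on [leRHS](bigD1 i) ?inE//=.
rewrite -expr2 lerDl.
by apply: sumr_ge0 => j _; rewrite -expr2 sqr_ge0.
Qed.

Lemma sublinear_le_mxnorm f : sublinear f ->
  exists2 C, 0 <= C & forall x : 'cV[R]_k, f x <= C * `|x^T|.
Proof.
move=> /sublinear_le_coord[C C0 fC]; exists C => // x; apply: fC => i.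
rewrite [leRHS]/Num.norm/= mx_normrE.
apply: le_trans (le_bigmax _ (fun ij => `|x^T ij.1 ij.2|) (0, i)).
by rewrite mxE.
Qed.

(** [f] is Lipschitz, being subadditive and bounded by a multiple of the norm,
    so it attains a positive minimum on the unit sphere; homogeneity does the
    rest.  The sphere is that of the sup norm on row vectors, which carries the
    topology and the Heine-Borel theorem. *)
Lemma sublinear_coercive f : sublinear f -> (forall x, 0 <= f x) ->
  (forall x, f x = 0 -> x = 0) ->
  exists2 a, 0 < a & forall x : 'cV[R]_k, a * norm2 x <= f x.
Proof.
move=> subf f_ge0 f_eq0.
have [fD fZ] := subf.
have [C C0 fC] := sublinear_le_mxnorm subf.
have [N N0 normN] : exists2 N, 0 <= N &
    forall x : 'cV[R]_k, norm2 x <= N * `|x^T|.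
  have idlin : linear (@id 'cV[R]_k) by [].
  have [N N0 HN] := sublinear_le_mxnorm
    (sublinear_norm_on [set: 'I_k]%SET idlin).
  by exists N => // x; rewrite norm2_setT.
pose F (r : 'rV[R]_k) := f r^T.
have F_le x y : F x - F y <= C * `|x - y|.
  rewrite lerBlDl; have := fC (x - y)^T; rewrite trmxK => H.
  apply: le_trans (_ : f y^T + f (x - y)^T <= _); last by rewrite lerD2l.
  by apply: le_trans (fD _ _); rewrite /F linearB/= addrC subrK.
have cF : continuous F.
  move=> x; apply/(@cvgrPdist_le _ _ _ (nbhs x)) => e e0.
  have C1 : 0 < C + 1 by lra.
  have := @cvgr_dist_le R 'rV[R]_k 'rV[R]_k (nbhs x) _ id x
    (@cvg_id _ (nbhs x)) (e / (C + 1)).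
  move/(_ _ (divr_gt0 e0 C1)); apply: filterS => y.
  rewrite ler_pdivlMr// mulrC => xy; apply: le_trans xy.
  apply: (@le_trans _ _ (C * `|x - y|)).
    by rewrite ler_norml lerNl opprB F_le andbT distrC F_le.
  by rewrite ler_wpM2r//; lra.
pose S := [set r : 'rV[R]_k | `|r| = 1].
have scaleS x : x != 0 -> S (`|x^T|^-1 *: x^T).
  move=> x0; rewrite /S/= normrZ normfV normr_id mulVf// normr_eq0.
  by apply: contra x0 => /eqP/(congr1 trmx); rewrite trmxK trmx0 => ->.
have cS : compact S.
  apply: bounded_closed_compact.
    exists 1; split=> // M M1 r /=; rewrite /S/= => ->; exact: ltW.
  rewrite (_ : S = Num.norm @^-1` [set 1 : R])//.
  apply: closed_comp; last exact: closed_eq.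
  by move=> r _; exact: norm_continuous.
have [a a0 Ha] : exists2 a, 0 < a & forall x, a * `|x^T| <= f x.
  (* the sphere is empty in dimension 0 *)
  have [S0|/set0P S0] := eqVneq S set0.
    exists 1 => // x; have [->|/scaleS] := eqVneq x 0; last by rewrite S0.
    by rewrite trmx0 normr0 mulr0.
  have [r rS minr] := compact_EVT_min S0 cS (continuous_subspaceT cF).
  exists (F r).
    rewrite lt_neqAle f_ge0 andbT eq_sym; apply/eqP => /f_eq0.
    move/(congr1 trmx); rewrite trmxK trmx0 => r0.
    by move: rS; rewrite inE /S/= r0 normr0 => /eqP; rewrite eq_sym oner_eq0.
  move=> x; have [->|x0] := eqVneq x 0; first by rewrite trmx0 normr0 mulr0.
  have := minr _ (mem_set (scaleS _ x0)); rewrite /F linearZ/= trmxK.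
  have nx0 : 0 < `|x^T|.
    rewrite normr_gt0; apply: contra x0 => /eqP/(congr1 trmx).
    by rewrite trmxK trmx0 => ->.
  by rewrite fZ ?invr_ge0// ler_pdivlMl// mulrC.
exists (a / (N + 1)) => [|x]; first by rewrite divr_gt0//; lra.
rewrite -mulrA; apply: le_trans (Ha x).
rewrite ler_pM2l// ler_pdivrMl; last by lra.
by apply: le_trans (normN x) _; rewrite ler_wpM2r//; lra.
Qed.

End Sublinear.

(** * Subgradients of the norm of one group *)

Section UnitDual.
Variables (R : realType) (n : nat) (J : {set 'I_n}).
Implicit Types (x z : 'cV[R]_n).

(** Equivalently, [z] restricted to [J] is a subgradient at [x] of the Euclidean
    norm on the coordinates in [J]. *)
Definition block_subgradient x z :=
  norm_on J z <= 1 /\ dot_on J z x = norm_on J x.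

(** For a subgradient [z] at some [x0], the Bregman distance of the norm of the
    group from [x0] to [x]; it does not depend on [x0] because
    [dot_on J z x0 = norm_on J x0]. *)
Definition gap z x := norm_on J x - dot_on J z x.

(** The part of [x] orthogonal to [z] on [J], provided that [z] has norm 1
    there. *)
Definition orthogonal_part z x : 'cV[R]_n := x - dot_on J z x *: z.

Lemma gap_ge0 z x : norm_on J z <= 1 -> 0 <= gap z x.
Proof.
move=> z1; rewrite subr_ge0; apply: le_trans (dot_on_le _ _ _) _.
by rewrite ler_piMl// norm_on_ge0.
Qed.

(** Equality case of Cauchy-Schwarz: the square of the norm of
    [x - norm_on J x *: z] is at most 0. *)
Lemma block_subgradient_scale x z : block_subgradient x z ->
  forall i, i \in J -> x i 0 = norm_on J x * z i 0.
Proof.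
move=> [z1 zx] i iJ.
have /norm_on_eq0/(_ i iJ) : norm_on J (x - norm_on J x *: z) = 0.
  apply/eqP; rewrite -sqrf_eq0; apply/eqP/le_anti.
  rewrite sqr_ge0 norm_on_sqr !dot_onE (dot_onC _ x z) zx -!norm_on_sqr andbT.
  have := norm_on_ge0 J z; have := norm_on_ge0 J x.
  set a := norm_on J x; set b := norm_on J z in z1 * => a0 b0.
  have : b ^+ 2 <= 1 by rewrite expr_le1.
  by have := sqr_ge0 a; nra.
by rewrite !mxE => /eqP; rewrite subr_eq0 => /eqP.
Qed.

Lemma block_subgradient_norm1 x z : block_subgradient x z ->
  0 < norm_on J x -> norm_on J z = 1.
Proof.
move=> [z1 zx] x0; apply/le_anti; rewrite z1/=.
by have := dot_on_le J z x; rewrite zx -ler_pdivrMr// divff// gt_eqF.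
Qed.

(** Strengthened monotonicity of the subdifferential: the product on the right
    is the sum of the two Bregman gaps, of which one is discarded. *)
Lemma gap_le_monotone x x' z z' :
  block_subgradient x z -> block_subgradient x' z' ->
  gap z x' <= dot_on J (z' - z) (x' - x).
Proof.
move=> [z1 zx] [z'1 zx']; have := gap_ge0 x z'1.
by rewrite /gap !dot_onE zx zx'; lra.
Qed.

(** Subgradients are Lipschitz at a nonzero point, with no smallness condition
    on [x' - x]: on [J], the vector [norm_on J x *: (z' - z)] is
    [norm_on J x *: z' - x], and [x'] is [norm_on J x' *: z']. *)
Lemma block_subgradient_calm x x' z z' :
  block_subgradient x z -> block_subgradient x' z' ->
  norm_on J x * norm_on J (z' - z) <= 2 * norm_on J (x' - x).
Proof.
move=> zx zx'; have [z'1 _] := zx'.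
rewrite -[norm_on J x in leLHS]ger0_norm ?norm_on_ge0// -norm_onZ.
rewrite (_ : norm_on J _ =
  norm_on J ((norm_on J x - norm_on J x') *: z' + (x' - x))); last first.
  have E i : i \in J -> (norm_on J x *: (z' - z)) i 0 =
      ((norm_on J x - norm_on J x') *: z' + (x' - x)) i 0.
    move=> iJ; rewrite !mxE (block_subgradient_scale zx iJ).
    rewrite (block_subgradient_scale zx' iJ).
    ring.
  by rewrite /norm_on (eq_dot_on E E).
apply: le_trans (ler_norm_onD _ _ _) _.
rewrite mulr2n mulrDl !mul1r lerD2r norm_onZ.
apply: (@le_trans _ _ `|norm_on J x - norm_on J x'|); first exact: ler_piMr.
have := ler_norm_onD J (x' - x) x; have := ler_norm_onD J (x - x') x'.
rewrite !subrK -{1}(norm_onN J (x' - x)) opprB ler_norml.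
have -> : norm_on J (x' - x) = norm_on J (x - x') by rewrite -norm_onN opprB.
lra.
Qed.

Lemma orthogonal_part_linear z : linear (orthogonal_part z).
Proof.
move=> a x y; apply/matrixP => i j.
by rewrite /orthogonal_part !dot_onE !mxE; ring.
Qed.

(** The left-hand side is [norm_on J x ^+ 2 - dot_on J z x ^+ 2], which factors
    as [gap z x * (norm_on J x + dot_on J z x)]. *)
Lemma norm_orthogonal_part_sqr z x : norm_on J z = 1 ->
  norm_on J (orthogonal_part z x) ^+ 2 <= 2 * norm_on J x * gap z x.
Proof.
move=> z1; rewrite norm_on_sqr /orthogonal_part !dot_onE (dot_onC _ x z).
rewrite -!norm_on_sqr z1.
have g0 : 0 <= gap z x by apply: gap_ge0; rewrite z1.
rewrite /gap in g0 *; set d := dot_on J z x in g0 *.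
set a := norm_on J x in g0 *.
by have := sqr_ge0 (a - d); nra.
Qed.

End UnitDual.

(** * Subgradients of the group norm *)

Section GroupNorm.
Variables (R : realType) (n : nat) (JJ : {set {set 'I_n}}).
Hypothesis hJJ : finset.partition JJ [set: 'I_n]%SET.
Implicit Types (x y z : 'cV[R]_n) (J : {set 'I_n}).

Lemma inner_blocks x y : inner x y = \sum_(J in JJ) dot_on J x y.
Proof. by rewrite inner_setT /dot_on (set_partition_big _ hJJ). Qed.

Lemma norm12_blocks x : norm12 JJ x = \sum_(J in JJ) norm_on J x.
Proof. by apply: eq_bigr => J _; rewrite norm2_subvec. Qed.

Lemma sublinear_norm12 : sublinear (@norm12 R n JJ).
Proof.
have -> : @norm12 R n JJ = fun x => \sum_(J in JJ) norm_on J x.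
  by apply/funext => x; exact: norm12_blocks.
by apply: sublinear_sum => J _; apply: (@sublinear_norm_on _ _ _ id).
Qed.

(** Changing [x] on [J] only turns the subgradient inequality into that of the
    norm of the group; the points [0], [x + x] and [x + z] then yield the two
    properties. *)
Lemma subdifferential_block x z J : subdifferential (norm12 JJ) x z ->
  J \in JJ -> block_subgradient J x z.
Proof.
move=> zx JJJ.
have key a : norm_on J x + dot_on J z (a - x) <= norm_on J a.
  pose x' : 'cV[R]_n := \col_i (if i \in J then a i 0 else x i 0).
  have x'J i : i \in J -> x' i 0 = a i 0 by rewrite mxE => ->.
  have x'J' J' i : J' \in JJ -> J' != J -> i \in J' -> x' i 0 = x i 0.
    move=> J'JJ J'J iJ'; rewrite mxE ifN//.
    have [_ /finset.trivIsetP/(_ J' J J'JJ JJJ J'J) + _] := and3P hJJ.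
    by move=> /disjoint_setI0/setP/(_ i); rewrite !inE iJ'/= => ->.
  have /= := zx x'; rewrite !norm12_blocks inner_blocks.
  rewrite (bigD1 J)//= [X in _ + X](bigD1 J)//= [leRHS](bigD1 J)//=.
  rewrite [X in _ + (_ + X)]big1 ?addr0; last first.
    move=> J' /andP[J'JJ J'J]; rewrite /dot_on big1// => i iJ'.
    by rewrite [(x' - x) i 0]mxE [(- x) i 0]mxE (x'J' J')// subrr mulr0.
  have -> : \sum_(i in JJ | i != J) norm_on i x' =
            \sum_(i in JJ | i != J) norm_on i x.
    apply: eq_bigr => J' /andP[J'JJ J'J]; congr Num.sqrt.
    by apply: eq_dot_on => i; exact: (x'J' J').
  rewrite -addrA [X in _ + X]addrC addrA lerD2r.
  rewrite (_ : norm_on J x' = norm_on J a); last first.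
    by congr Num.sqrt; apply: eq_dot_on => i; exact: x'J.
  rewrite (_ : dot_on J z (x' - x) = dot_on J z (a - x))//.
  by apply: eq_dot_on => // i iJ; rewrite [LHS]mxE x'J// !mxE.
split.
  have := key (x + z); rewrite [x + z]addrC addrK.
  have := ler_norm_onD J z x; rewrite -norm_on_sqr.
  by have := norm_on_ge0 J z; nra.
apply/le_anti/andP; split.
  by have := key (x + x); rewrite addrK; have := ler_norm_onD J x x; lra.
have := key 0; rewrite sub0r dot_onNr.
have -> : norm_on J 0 = 0 :> R.
  by rewrite -(scale0r (0 : 'cV[R]_n)) norm_onZ normr0 mul0r.
lra.
Qed.

End GroupNorm.

(** * Optimality in the penalized problem *)

Section Adjoint.
Variables (R : realType) (m n : nat) (Phi : 'M[R]_(m, n)).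

Lemma inner_trmx u x : inner (Phi^T *m u) x = inner u (Phi *m x).
Proof.
have E k (a b : 'cV[R]_k) : inner a b = (a^T *m b) 0 0.
  by rewrite mxE; apply: eq_bigr => i _; rewrite mxE.
by rewrite !E trmx_mul trmxK mulmxA.
Qed.

Lemma mulmx_col_linear p (A : 'M[R]_(p, n)) :
  linear (fun x : 'cV[R]_n => A *m x).
Proof. by move=> a x y; rewrite mulmxDr scalemxAr. Qed.

Lemma trblock_subvec J u : (colblock Phi J)^T *m u = subvec J (Phi^T *m u).
Proof.
by apply/matrixP => i j; rewrite !mxE; apply: eq_bigr => l _; rewrite !mxE ord1.
Qed.

End Adjoint.

Lemma inner_le (R : realType) k (x y : 'cV[R]_k) :
  inner x y <= norm2 x * norm2 y.
Proof. by rewrite inner_setT !norm2_setT dot_on_le. Qed.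

Lemma norm2_ge0 (R : realType) k (x : 'cV[R]_k) : 0 <= norm2 x.
Proof. exact: sqrtr_ge0. Qed.

Lemma norm2_eq0 (R : realType) k (x : 'cV[R]_k) : norm2 x = 0 -> x = 0.
Proof.
rewrite norm2_setT => /norm_on_eq0 x0.
by apply/matrixP => i j; rewrite ord1 mxE x0 ?inE.
Qed.

(** If [A] were negative then [t = 1] would force [- A <= B], and the value at
    [t = - A / (B - A)] would be negative. *)
Lemma ge0_of_quadratic (R : realType) (A B : R) :
  (forall t, 0 < t <= 1 -> 0 <= t * A + t ^+ 2 * B) -> 0 <= A.
Proof.
move=> H; rewrite leNgt; apply/negP => A0.
have B0 : 0 < B.
  have := H 1; rewrite ltr01 lexx expr1n !mul1r => /(_ isT); lra.
have tp : 0 < (- A) / (B - A) by apply: divr_gt0; lra.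
have [t0 t1] : 0 < (- A) / (B - A) /\ (- A) / (B - A) <= 1.
  by split=> //; rewrite ler_pdivrMr ?mul1r; lra.
have := H _ (introT andP (conj t0 t1)).
have : (- A) / (B - A) * (B - A) = - A by rewrite divfK// gt_eqF//; lra.
set t := _ / _ in t0 t1 *.
by move=> E; rewrite expr2 -mulrA -mulrDr pmulr_rge0//; nra.
Qed.

(** Fermat's rule: compare [x] with [x + t *: (x' - x)], bound the penalty by
    convexity, and let [t] tend to 0. *)
Lemma minimizer_subdifferential (R : realType) (m n : nat)
    (JJ : {set {set 'I_n}}) (Phi : 'M[R]_(m, n)) y mu x : 0 < mu ->
  minimizer (penalized JJ Phi y mu) [set: 'cV[R]_n] x ->
  subdifferential (norm12 JJ) x (Phi^T *m (mu^-1 *: (y - Phi *m x))).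
Proof.
move=> mu0 [_ minx] x' /=; set d := x' - x.
set r := y - Phi *m x; rewrite inner_trmx inner_setT dot_onZl -inner_setT.
have [gD gZ] := @sublinear_norm12 R n JJ.
suff : 0 <= mu * (norm12 JJ x' - norm12 JJ x) - inner r (Phi *m d).
  move=> H; rewrite -(ler_pM2l mu0) mulrDr mulrA divff ?gt_eqF// mul1r.
  by move: H; rewrite mulrBr; lra.
apply: (@ge0_of_quadratic _ _ (2^-1 * norm2 (Phi *m d) ^+ 2)) => t /andP[t0 t1].
have := minx (x + t *: d) I; rewrite /penalized.
have -> : Phi *m x - y = - r by rewrite opprB.
have -> : Phi *m (x + t *: d) - y = - (r - t *: (Phi *m d)).
  by rewrite mulmxDr -scalemxAr /r !opprB addrAC addrC.
clearbody r.
rewrite !norm2_setT !norm_onN !norm_on_sqr !dot_onE -!inner_setT.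
have -> : inner (Phi *m d) r = inner r (Phi *m d).
  by rewrite !inner_setT dot_onC.
have : norm12 JJ (x + t *: d) <= (1 - t) * norm12 JJ x + t * norm12 JJ x'.
  rewrite -!gZ ?subr_ge0 ?(ltW t0)//; apply: le_trans (gD _ _).
  by rewrite scalerBl scale1r /d scalerBr addrA addrAC.
move: (norm12 _ (x + _)) => G HG.
rewrite -(ler_pM2l mu0) in HG.
move=> ?; nra.
Qed.

(** * First-order estimates *)

Section FirstOrder.
Variables (R : realType) (m n : nat) (JJ : {set {set 'I_n}}).
Hypothesis hJJ : finset.partition JJ [set: 'I_n]%SET.
Variables (Phi : 'M[R]_(m, n)) (x0 v : 'cV[R]_n) (u0 : 'cV[R]_m).
Hypothesis vE : v = Phi^T *m u0.
Hypothesis hv : subdifferential (norm12 JJ) x0 v.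
Implicit Types (x : 'cV[R]_n) (J : {set 'I_n}).

Let v_subgradient J : J \in JJ -> block_subgradient J x0 v.
Proof. exact: subdifferential_block. Qed.

Lemma sum_gap x : \sum_(J in JJ) gap J v x =
  norm12 JJ x - norm12 JJ x0 - inner u0 (Phi *m (x - x0)).
Proof.
have -> : norm12 JJ x0 = inner v x0.
  rewrite norm12_blocks (inner_blocks hJJ); apply: eq_bigr => J JJJ.
  by have [_ ->] := v_subgradient JJJ.
rewrite -inner_trmx -vE -addrA -opprD !inner_setT -dot_onDr.
by rewrite (addrC x0) subrK -inner_setT norm12_blocks (inner_blocks hJJ) -sumrB.
Qed.

(** The energy of [x] is at most that of [x0], which is
    [c * delta * norm12 JJ x0] up to [delta ^+ 2 / 2].  The linear term
    [inner u0 (Phi *m h)] of the sum of the gaps is bounded by the residual, so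
    the comparison is a quadratic inequality in the residual. *)
Lemma residual_and_gap_bound c : 0 < c -> exists2 C, 0 <= C &
  forall delta y x, 0 < delta -> norm2 (y - Phi *m x0) <= delta ->
    minimizer (penalized JJ Phi y (c * delta)) [set: 'cV[R]_n] x ->
    norm2 (Phi *m (x - x0)) <= C * delta /\
    \sum_(J in JJ) gap J v x <= C * delta.
Proof.
move=> c0; set U := norm2 u0; have U0 : 0 <= U by exact: norm2_ge0.
have ci0 : 0 < (2 * c)^-1 by rewrite invr_gt0; lra.
exists (2 + 2 * c * U + ((2 * c)^-1 + U * (2 + 2 * c * U))) =>
  [|d y x d0 yd [_ minx]].
  have : 0 <= c * U by rewrite mulr_ge0// ltW.
  by nra.
have cU : 0 <= c * U by rewrite mulr_ge0// ltW.
set D := \sum_(J in JJ) _.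
have D0 : 0 <= D.
  by apply: sumr_ge0 => J JJJ; apply: gap_ge0; have [] := v_subgradient JJJ.
set b := norm2 (Phi *m x - y); have b0 : 0 <= b by exact: norm2_ge0.
set e := norm2 (Phi *m (x - x0)); have e0 : 0 <= e by exact: norm2_ge0.
have eb : e <= b + d.
  have -> : e = norm2 ((Phi *m x - y) + (y - Phi *m x0)).
    by rewrite addrA subrK -mulmxBr.
  rewrite norm2_setT; apply: le_trans (ler_norm_onD _ _ _) _.
  by rewrite -!norm2_setT lerD2l.
have DE : D = norm12 JJ x - norm12 JJ x0 - inner u0 (Phi *m (x - x0)).
  exact: sum_gap.
have : - inner u0 (Phi *m (x - x0)) <= U * e.
  rewrite inner_setT -dot_onNl -inner_setT; apply: le_trans (inner_le _ _) _.
  by rewrite /U /e !norm2_setT norm_onN.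
move: DE; set w := inner u0 _ => DE wU.
have := minx x0 I; rewrite /penalized -/b.
have -> : norm2 (Phi *m x0 - y) = norm2 (y - Phi *m x0).
  by rewrite !norm2_setT -norm_onN opprB.
have : norm2 (y - Phi *m x0) ^+ 2 <= d ^+ 2.
  by rewrite lerXn2r ?nnegrE ?norm2_ge0// ltW.
move: (norm2 (y - _) ^+ 2) => Y2 HY minx0.
have cd0 : 0 < c * d by exact: mulr_gt0.
(* the comparison of energies, where D is the sum of the gaps *)
have main : b ^+ 2 / 2 + c * d * D <= d ^+ 2 / 2 + c * d * (U * (b + d)).
  have : c * d * (- w) <= c * d * (U * (b + d)).
    by rewrite ler_pM2l// (le_trans wU)// ler_wpM2l.
  by rewrite DE; move: minx0; nra.
have bd : b <= (1 + 2 * c * U) * d.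
  rewrite leNgt; apply/negP => lt_b.
  have cdD : 0 <= c * d * D by rewrite mulr_ge0// ltW.
  have h1 : (1 + 2 * c * U) * d * b < b * b by rewrite ltr_pM2r//; nra.
  have h2 : d * ((1 + 2 * c * U) * d) <= d * b by rewrite ler_pM2l// ltW.
  by nra.
split; first by have := mulr_ge0 U0 (ltW d0); have := mulr_ge0 U0 cU; nra.
have : c * d * D <= c * d * (((2 * c)^-1 + U * (2 + 2 * c * U)) * d).
  have -> : c * d * (((2 * c)^-1 + U * (2 + 2 * c * U)) * d) =
     d ^+ 2 / 2 + c * d * (U * ((2 + 2 * c * U) * d)) by field; lra.
  have : c * d * (U * (b + d)) <= c * d * (U * ((2 + 2 * c * U) * d)).
    by rewrite ler_pM2l// ler_wpM2l//; nra.
  by have := sqr_ge0 b; nra.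
rewrite ler_pM2l// => /le_trans; apply; rewrite ler_pM2r//; nra.
Qed.

End FirstOrder.

(** * Second-order estimates *)

Section Stability.
Variables (R : realType) (m n : nat) (JJ : {set {set 'I_n}}).
Hypothesis hJJ : finset.partition JJ [set: 'I_n]%SET.
Variables (Phi : 'M[R]_(m, n)) (x0 v : 'cV[R]_n) (u0 : 'cV[R]_m).
Hypothesis vE : v = Phi^T *m u0.
Hypothesis hv : subdifferential (norm12 JJ) x0 v.
Implicit Types (x : 'cV[R]_n) (J : {set 'I_n}).

Let v_subgradient J : J \in JJ -> block_subgradient J x0 v.
Proof. exact: subdifferential_block. Qed.

Let active_sub J : J \in active JJ x0 -> J \in JJ.
Proof. by rewrite inE => /andP[]. Qed.

Let inactive_sub J : J \in inactive JJ x0 -> J \in JJ.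
Proof. by rewrite inE => /andP[]. Qed.

Lemma active_norm_gt0 J : J \in active JJ x0 -> 0 < norm_on J x0.
Proof.
rewrite inE lt_neqAle norm_on_ge0 andbT => /andP[_]; apply: contra => /eqP H.
by apply/eqP/subvec_eq0/norm_on_eq0.
Qed.

Lemma inactive_eq0 J : J \in inactive JJ x0 -> forall i, i \in J -> x0 i 0 = 0.
Proof.
by rewrite !inE andbC => /andP[-> /=]; rewrite negbK => /eqP/subvec_eq0.
Qed.

Lemma big_active_inactive (F : {set 'I_n} -> R) : \sum_(J in JJ) F J =
  \sum_(J in active JJ x0) F J + \sum_(J in inactive JJ x0) F J.
Proof.
rewrite (big_setID (active JJ x0)) (finset.setIidPr _)//.
by apply/fintype.subsetP => J; rewrite inE => /andP[].
Qed.

Let v_unit J : J \in active JJ x0 -> norm_on J v = 1.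
Proof.
move=> JI.
exact: block_subgradient_norm1 (v_subgradient (active_sub JI))
  (active_norm_gt0 JI).
Qed.

Lemma direction_subvec J : J \in active JJ x0 -> direction x0 J = subvec J v.
Proof.
move=> JI; have x0J := active_norm_gt0 JI.
rewrite /direction norm2_subvec; apply/matrixP => i j; rewrite !mxE.
rewrite (block_subgradient_scale (v_subgradient (active_sub JI)) (enum_valP i)).
rewrite mulrA.
by rewrite mulVf ?mul1r// gt_eqF.
Qed.

Lemma sublinear_gap J (z : 'cV[R]_n) : sublinear (gap J z).
Proof.
have -> : gap J z = fun x => norm_on J (id x) + dot_on J (id x) (- z).
  by apply/funext => x; rewrite /gap dot_onNr dot_onC.
by apply: sublinear_add; [apply: sublinear_norm_on|apply: sublinear_dot_on].
Qed.

(** At a zero [w] of the right-hand side, [inner v w = inner u0 (Phi *m w) = 0]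
    splits over the groups into the sum that defines [Wset], and [w] is
    colinear to [v], hence to [x0], on every active group. *)
Lemma kernel_coercive :
  Wset JJ Phi x0 `&` Eset JJ x0 = [set 0] ->
  exists2 a, 0 < a & forall w : 'cV[R]_n, a * norm2 w <=
    norm2 (Phi *m w) +
    (\sum_(J in active JJ x0) norm_on J (orthogonal_part J v w) +
     \sum_(J in inactive JJ x0) gap J v w).
Proof.
move=> hW.
have tan_ge0 w :
    0 <= \sum_(J in active JJ x0) norm_on J (orthogonal_part J v w).
  by apply: sumr_ge0 => J _; exact: norm_on_ge0.
have gapJ_ge0 w J : J \in inactive JJ x0 -> 0 <= gap J v w.
  by move=> /inactive_sub/v_subgradient[? _]; exact: gap_ge0.
have gaps_ge0 w : 0 <= \sum_(J in inactive JJ x0) gap J v w.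
  by apply: sumr_ge0 => J; exact: gapJ_ge0.
apply: sublinear_coercive => [|w|w].
- apply: sublinear_add.
    have -> : (fun w : 'cV[R]_n => norm2 (Phi *m w)) =
        fun w => norm_on [set: 'I_m]%SET (Phi *m w).
      by apply/funext => w; rewrite norm2_setT.
    by apply: sublinear_norm_on; exact: mulmx_col_linear.
  apply: sublinear_add; apply: sublinear_sum => J _; last exact: sublinear_gap.
  by apply: sublinear_norm_on; exact: orthogonal_part_linear.
- by rewrite addr_ge0 ?norm2_ge0 ?addr_ge0.
move/eqP; rewrite paddr_eq0 ?norm2_ge0 ?addr_ge0// paddr_eq0//.
move=> /andP[/eqP/norm2_eq0 Pw /andP[/eqP tan0 /eqP gap0]].
have tanJ J : J \in active JJ x0 ->
    forall i, i \in J -> w i 0 = dot_on J v w * v i 0.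
  move=> JI i iJ.
  have /norm_on_eq0/(_ i iJ)/eqP : norm_on J (orthogonal_part J v w) = 0.
    by apply: (psumr_eq0P _ tan0) => // ? _; exact: norm_on_ge0.
  by rewrite !mxE subr_eq0 => /eqP.
suff : (Wset JJ Phi x0 `&` Eset JJ x0) w by rewrite hW.
split.
  split=> //.
  have -> : \sum_(J in active JJ x0) inner (direction x0 J) (subvec J w) =
            \sum_(J in active JJ x0) dot_on J v w.
    by apply: eq_bigr => J JI; rewrite direction_subvec// inner_subvec.
  have -> : \sum_(J in inactive JJ x0) norm2 (subvec J w) =
            \sum_(J in inactive JJ x0) dot_on J v w.
    apply/eqP; rewrite -subr_eq0 -sumrB; apply/eqP; rewrite -[RHS]gap0.
    apply: eq_bigr => J _.
    by rewrite norm2_subvec.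
  rewrite -big_active_inactive -(inner_blocks hJJ) vE inner_trmx Pw inner_setT.
  by rewrite -(scale0r (0 : 'cV[R]_m)) dot_onZr mul0r.
move=> J JI; exists (dot_on J v w / norm_on J x0).
have x0J := active_norm_gt0 JI.
apply/matrixP => i j; rewrite !mxE (tanJ J JI _ (enum_valP i)).
rewrite (block_subgradient_scale (v_subgradient (active_sub JI)) (enum_valP i)).
rewrite mulrA.
by rewrite divfK// gt_eqF.
Qed.

Hypothesis hK : forall z : blockvec R (saturated JJ x0 v),
    (trblocks Phi (saturated JJ x0 v) @` ker_trblocks Phi (active JJ x0)) z ->
    (forall J : {J : {set 'I_n} | J \in saturated JJ x0 v},
        0 <= inner (z J) (subvec (val J) v)) ->
    z = blockvec0 R (saturated JJ x0 v).

Let supp := active JJ x0 :|: saturated JJ x0 v.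

(** Coercivity of the function [G] below.  It vanishes at [u] only if [- u]
    has an image satisfying the premises of [hK] and [u = P *m u]; then
    [M *m u = 0], whence [u = 0].  The conclusion depends on [u] only through
    [M *m u], so coercivity may be applied to the projection [P *m u]. *)
Lemma dual_calm :
  exists2 C, 0 <= C & forall u : 'cV[R]_m,
    (forall J, J \in saturated JJ x0 v -> dot_on J (Phi^T *m u) v <= 0) ->
    exists2 u' : 'cV[R]_m,
      norm2 u' <= C * \sum_(J in active JJ x0) norm_on J (Phi^T *m u) &
      forall J i, J \in supp -> i \in J -> (Phi^T *m u') i 0 = (Phi^T *m u) i 0.
Proof.
(* M keeps the rows of Phi^T in the active and saturated groups; P is a
   projector with the kernel of M, which selects one preimage of each vector
   in the image of M. *)
pose M : 'M[R]_(n, m) := \matrix_(i, j)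
  if [exists J in supp, i \in J] then Phi^T i j else 0.
have ME (u : 'cV[R]_m) J i :
    J \in supp -> i \in J -> (M *m u) i 0 = (Phi^T *m u) i 0.
  move=> JS iJ; rewrite !mxE; apply: eq_bigr => j _; rewrite !mxE.
  by case: ifPn => // /negP[]; apply/existsP; exists J; rewrite JS.
have M0 (u : 'cV[R]_m) :
    (forall J i, J \in supp -> i \in J -> (Phi^T *m u) i 0 = 0) -> M *m u = 0.
  move=> H; apply/matrixP => i j; rewrite ord1 [RHS]mxE.
  have [/existsP[J /andP[JS iJ]]|H'] := boolP [exists J in supp, i \in J].
    by rewrite (ME _ J)// (H J).
  by rewrite mxE big1// => l _; rewrite mxE (negbTE H') mul0r.
pose P := pinvmx M *m M.
have MpM : M *m pinvmx M *m M = M by apply: mulmxKpV; exact: submx_refl.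
have MP (u : 'cV[R]_m) : M *m (P *m u) = M *m u by rewrite /P 2!mulmxA MpM.
pose G (u : 'cV[R]_m) := \sum_(J in active JJ x0) norm_on J (Phi^T *m u)
  + (\sum_(J in saturated JJ x0 v) Num.max 0 (dot_on J (Phi^T *m u) v)
     + norm2 (u - P *m u)).
have n_ge0 (u : 'cV[R]_m) :
    0 <= \sum_(J in active JJ x0) norm_on J (Phi^T *m u).
  by apply: sumr_ge0 => J _; exact: norm_on_ge0.
have p_ge0 (u : 'cV[R]_m) : 0 <=
    \sum_(J in saturated JJ x0 v) Num.max 0 (dot_on J (Phi^T *m u) v).
  by apply: sumr_ge0 => J _; rewrite le_max lexx.
have [a a0 Ga] : exists2 a, 0 < a & forall u, a * norm2 u <= G u.
  apply: sublinear_coercive => [|u|u].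
  - apply: sublinear_add.
      apply: sublinear_sum => J _; apply: sublinear_norm_on.
      exact: mulmx_col_linear.
    apply: sublinear_add.
      apply: sublinear_sum => J _; apply: sublinear_pos.
      apply: sublinear_dot_on.
      exact: mulmx_col_linear.
    have -> : (fun u : 'cV[R]_m => norm2 (u - P *m u)) =
        fun u => norm_on [set: 'I_m]%SET (u - P *m u).
      by apply/funext => u; rewrite norm2_setT.
    apply: sublinear_norm_on => b x y.
    by rewrite mulmxDr -scalemxAr scalerBr opprD addrACA.
  - by rewrite !addr_ge0 ?norm2_ge0.
  move/eqP; rewrite paddr_eq0 ?addr_ge0 ?norm2_ge0// paddr_eq0 ?norm2_ge0//.
  move=> /and3P[/eqP I0 /eqP K0 /eqP/norm2_eq0/eqP].
  rewrite subr_eq0 => /eqP uP.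
  have uI J i : J \in active JJ x0 -> i \in J -> (Phi^T *m u) i 0 = 0.
    move=> JI; apply: norm_on_eq0.
    by apply: (psumr_eq0P _ I0) => // ? _; exact: norm_on_ge0.
  have uK J : J \in saturated JJ x0 v -> dot_on J (Phi^T *m u) v <= 0.
    move=> JK; have : Num.max 0 (dot_on J (Phi^T *m u) v) = 0.
      by apply: (psumr_eq0P _ K0) => // ? _; rewrite le_max lexx.
    by move=> <-; rewrite le_max lexx orbT.
  have kerN : ker_trblocks Phi (active JJ x0) (- u).
    apply: functional_extensionality_dep => -[J JI].
    rewrite /trblocks trblock_subvec /blockvec0 /=.
    by apply/subvec_eq0 => i iJ; rewrite mulmxN mxE (uI J)// oppr0.
  have zK := hK (ex_intro2 _ _ _ kerN erefl).
  rewrite uP /P -mulmxA M0 ?mulmx0// => J i.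
  rewrite finset.in_setU => /orP[/uI|JK iJ]; first exact.
  have := zK _.
  move=> /(_ _)/(congr1 (fun z => z (exist _ J JK))).
  rewrite /trblocks trblock_subvec /blockvec0 /= => H.
  have /subvec_eq0/(_ i iJ) : subvec J (Phi^T *m - u) = 0.
    apply: H => -[J' J'K]; rewrite trblock_subvec inner_subvec mulmxN dot_onNl.
    by rewrite oppr_ge0 uK.
  by rewrite mulmxN mxE => /eqP; rewrite oppr_eq0 => /eqP.
exists a^-1 => [|u uK]; first by rewrite invr_ge0 ltW.
have PE J i : J \in supp -> i \in J ->
    (Phi^T *m (P *m u)) i 0 = (Phi^T *m u) i 0.
  by move=> JS iJ; rewrite -!(ME _ J)// MP.
exists (P *m u) => //; rewrite ler_pdivlMl//; apply: le_trans (Ga _) _.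
rewrite /G [X in _ + (X + _)]big1 => [|J JK]; last first.
  apply/max_idPl; apply: le_trans (uK J JK).
  rewrite le_eqVlt; apply/predU1P; left.
  by apply: eq_dot_on => // i; apply: PE; rewrite finset.in_setU JK orbT.
rewrite add0r [P *m (P *m u)](_ : _ = P *m u); last first.
  by rewrite {1}/P -mulmxA MP mulmxA.
rewrite subrr norm2_setT -(scale0r (0 : 'cV[R]_m)) norm_onZ normr0 mul0r addr0.
apply: ler_sum => J JI; rewrite le_eqVlt; apply/predU1P; left; congr Num.sqrt.
by apply: eq_dot_on => i; apply: PE; rewrite finset.in_setU JI.
Qed.

(** A bound with the extra factor [norm2 (x - x0)] compared with the first-order
    estimate.  It comes from evaluating [inner u' (Phi *m (x - x0))] group by
    group, for the vector [u'] of [dual_calm] that represents the difference of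
    the subgradients at [x] and [x0]. *)
Lemma active_gap_calm :
  exists2 C, 0 <= C & forall (x : 'cV[R]_n) (u : 'cV[R]_m) eta,
    subdifferential (norm12 JJ) x (Phi^T *m u) -> 0 <= eta ->
    norm2 (Phi *m (x - x0)) <= eta -> \sum_(J in JJ) gap J v x <= eta ->
    forall J, J \in active JJ x0 -> gap J v x <= C * norm2 (x - x0) * eta.
Proof.
have [C C0 HC] := dual_calm.
have [B B0 HB] : exists2 B, 0 <= B &
    forall u : 'cV[R]_m, norm2 (Phi^T *m u) <= B * norm2 u.
  have [B B0 HB] := sublinear_le_norm2
    (sublinear_norm_on [set: 'I_n]%SET (mulmx_col_linear Phi^T)).
  by exists B => // u; rewrite norm2_setT.
(* On these groups the gap is at least (1 - |v|_J) |x|_J, so it controls the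
   whole error; slack collects the constants. *)
pose free := inactive JJ x0 :\: saturated JJ x0 v.
pose slack := \sum_(J in free) (1 - norm_on J v)^-1.
pose rate := \sum_(J in active JJ x0) 2 / norm_on J x0.
have free_lt1 J : J \in free -> norm_on J v < 1.
  rewrite finset.in_setD => /andP[JK JI]; rewrite lt_neqAle.
  have [-> _] := v_subgradient (inactive_sub JI); rewrite andbT.
  by apply: contra JK => JK; rewrite inE JI norm2_subvec.
have slack0 : 0 <= slack.
  by apply: sumr_ge0 => J /free_lt1 J1; rewrite invr_ge0 subr_ge0 ltW.
have rate0 : 0 <= rate.
  by apply: sumr_ge0 => J _; rewrite divr_ge0// norm_on_ge0.
exists (C * rate * (1 + B * slack)) => [|x u eta sx eta0 Phix gapx J JI].
  by rewrite !mulr_ge0// addr_ge0// mulr_ge0.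
pose s := Phi^T *m u; pose h := x - x0.
have s_subgradient J' : J' \in JJ -> block_subgradient J' x s.
  exact: subdifferential_block.
have sv : Phi^T *m (u - u0) = s - v by rewrite mulmxBr vE.
have [|u' u'_le u'E] := HC (u - u0).
  move=> J'; rewrite !inE norm2_subvec => /andP[/andP[_ J'JJ] /eqP v1].
  have [s1 _] := s_subgradient _ J'JJ.
  rewrite sv dot_onDl dot_onNl -norm_on_sqr v1 expr1n subr_le0.
  by apply: le_trans (dot_on_le _ _ _) _; rewrite v1 mulr1.
have u'_rate : norm2 u' <= C * rate * norm2 h.
  apply: le_trans u'_le _; rewrite -mulrA ler_wpM2l// mulr_suml.
  apply: ler_sum => J' J'I.
  have x0J' := active_norm_gt0 J'I.
  rewrite sv mulrAC ler_pdivlMr// mulrC.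
  apply: le_trans (block_subgradient_calm (v_subgradient (active_sub J'I))
    (s_subgradient _ (active_sub J'I))) _.
  by rewrite ler_wpM2l// norm2_setT norm_onS// finset.subsetT.
have suppE J' : J' \in supp -> dot_on J' (Phi^T *m u') h = dot_on J' (s - v) h.
  by move=> J'S; apply: eq_dot_on => // i iJ'; rewrite (u'E J')// sv.
have mono J' : J' \in JJ -> gap J' v x <= dot_on J' (s - v) h.
  by move=> J'JJ; apply: gap_le_monotone;
    [exact: v_subgradient|exact: s_subgradient].
have v_gap J' x' : J' \in JJ -> 0 <= gap J' v x'.
  by move=> /v_subgradient[v1 _]; exact: gap_ge0.
have free_h J' : J' \in free -> norm_on J' h <= (1 - norm_on J' v)^-1 * eta.
  move=> J'F; rewrite ler_pdivlMl ?subr_gt0 ?free_lt1//.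
  have J'I : J' \in inactive JJ x0.
    by move: J'F; rewrite finset.in_setD => /andP[].
  have J'JJ := inactive_sub J'I.
  have hx i : i \in J' -> h i 0 = x i 0.
    by move=> iJ'; rewrite !mxE (inactive_eq0 J'I)// subr0.
  have -> : norm_on J' h = norm_on J' x by congr Num.sqrt; exact: eq_dot_on.
  apply: le_trans (_ : gap J' v x <= _).
    by rewrite mulrBl mul1r lerD2l lerN2 dot_on_le.
  apply: le_trans gapx; rewrite (bigD1 J')//= lerDl.
  by apply: sumr_ge0 => J'' /andP[J''JJ _]; exact: v_gap.
have total : inner u' (Phi *m h) =
    \sum_(J' in active JJ x0) dot_on J' (s - v) h +
    (\sum_(J' in saturated JJ x0 v) dot_on J' (s - v) h +
     \sum_(J' in free) dot_on J' (Phi^T *m u') h).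
  rewrite -inner_trmx (inner_blocks hJJ) big_active_inactive; congr (_ + _).
    by apply: eq_bigr => J' J'I; rewrite suppE// finset.in_setU J'I.
  rewrite (big_setID (saturated JJ x0 v)) (finset.setIidPr _)/=; last first.
    by apply/fintype.subsetP => J'; rewrite !inE => /andP[].
  congr (_ + _); apply: eq_bigr => J' J'K.
  by rewrite suppE// finset.in_setU J'K orbT.
have free_le : - \sum_(J' in free) dot_on J' (Phi^T *m u') h
    <= B * norm2 u' * (slack * eta).
  rewrite -sumrN mulr_suml mulr_sumr ler_sum// => J' J'F.
  rewrite -dot_onNl; apply: le_trans (dot_on_le _ _ _) _; rewrite norm_onN.
  rewrite ler_pM ?norm_on_ge0 ?free_h//; apply: le_trans (HB _).
  by rewrite norm2_setT norm_onS// finset.subsetT.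
have main : inner u' (Phi *m h) <= norm2 u' * eta.
  by apply: le_trans (inner_le _ _) _; rewrite ler_wpM2l// norm2_ge0.
have active_le : gap J v x <= \sum_(J' in active JJ x0) dot_on J' (s - v) h.
  rewrite (bigD1 J)//=; apply: le_trans (mono _ (active_sub JI)) _.
  rewrite lerDl; apply: sumr_ge0 => J' /andP[/active_sub J'JJ _].
  by apply: le_trans (mono _ J'JJ); exact: v_gap.
have sat_ge0 : 0 <= \sum_(J' in saturated JJ x0 v) dot_on J' (s - v) h.
  apply: sumr_ge0 => J' J'K; have J'JJ : J' \in JJ.
    by move: J'K; rewrite inE => /andP[/inactive_sub].
  by apply: le_trans (mono _ J'JJ); exact: v_gap.
apply: (@le_trans _ _ (norm2 u' * (1 + B * slack) * eta)).
  by move: main free_le; rewrite total; lra.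
rewrite ler_wpM2r// [leRHS]mulrAC ler_wpM2r// addr_ge0// mulr_ge0//.
Qed.

(** The orthogonal part of [x0] is 0, since its gap is. *)
Lemma active_orthogonal_part_bound x J : J \in active JJ x0 ->
  norm_on J (orthogonal_part J v (x - x0)) ^+ 2 <= 2 * norm_on J x * gap J v x.
Proof.
move=> JI; apply: le_trans (norm_orthogonal_part_sqr x (v_unit JI)).
rewrite lerXn2r ?nnegrE ?norm_on_ge0//.
have tan0 : norm_on J (orthogonal_part J v x0) = 0.
  apply/eqP; rewrite -sqrf_eq0; apply/eqP/le_anti.
  rewrite sqr_ge0 (le_trans (norm_orthogonal_part_sqr x0 (v_unit JI)))//.
  have [_ vx0] := v_subgradient (active_sub JI).
  by rewrite /gap vx0 subrr mulr0.
have -> : orthogonal_part J v (x - x0) =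
          - orthogonal_part J v x0 + orthogonal_part J v x.
  have := orthogonal_part_linear J v (-1) x0 x; rewrite !scaleN1r => <-.
  by rewrite addrC.
by apply: le_trans (ler_norm_onD _ _ _) _; rewrite norm_onN tan0 add0r.
Qed.

End Stability.

(** * Stable recovery *)

Theorem corollary4p9 (R : realType) (m n q : nat) (JJ : {set {set 'I_n}})
    (hJJ : finset.partition JJ [set: 'I_n]%SET) (hq : #|JJ| = q)
    (Phi : 'M[R]_(m, n)) (y0 : 'cV[R]_m) (x0 : 'cV[R]_n)
    (hx0 : minimizer (norm12 JJ) [set x : 'cV[R]_n | Phi *m x = y0] x0)
    (v : 'cV[R]_n)
    (hv : (subdifferential (norm12 JJ) x0 `&`
           range (fun u : 'cV[R]_m => Phi^T *m u)) v)
    (hW : Wset JJ Phi x0 `&` Eset JJ x0 = [set 0])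
    (hK : forall z : blockvec R (saturated JJ x0 v),
        (trblocks Phi (saturated JJ x0 v) @`
           ker_trblocks Phi (active JJ x0)) z ->
        (forall J : {J : {set 'I_n} | J \in saturated JJ x0 v},
            0 <= inner (z J) (subvec (val J) v)) ->
        z = blockvec0 R (saturated JJ x0 v)) :
  stable_recovery JJ Phi y0 x0.
Proof.
have [Phix0 _] := hx0; rewrite /= in Phix0.
have [sv [u0 _ vE]] := hv; have {}vE : v = Phi^T *m u0 by [].
move=> c c0.
have [a a0 Ha] := kernel_coercive hJJ vE sv hW.
have [C C_ge0 HC] := residual_and_gap_bound hJJ vE sv c0.
have [A A_ge0 HA] := active_gap_calm hJJ vE sv hK.
have gap_pos x J : J \in JJ -> 0 <= gap J v x.
  by move=> /(subdifferential_block hJJ sv)[v1 _]; exact: gap_ge0.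
pose M := C + norm12 JJ x0 + norm2 u0 * C.
have M_ge0 : 0 <= M.
  rewrite !addr_ge0 ?mulr_ge0 ?norm2_ge0// norm12_blocks.
  by apply: sumr_ge0 => J _; exact: norm_on_ge0.
pose Q := 2 * M * (A * C); have Q_ge0 : 0 <= Q by rewrite !mulr_ge0.
pose N : R := #|active JJ x0|%:R; have N_ge0 : 0 <= N by exact: ler0n.
(* By the inequality 2 p q <= (p + q)^2, a term sqrt (Q t delta) is at most
   eps t + (Q / eps) delta; with this eps, all the active groups together use up
   at most half of the coercivity constant a. *)
pose eps := a / (2 * (N + 1)).
have eps0 : 0 < eps by rewrite divr_gt0// mulr_gt0//; lra.
pose L := 2 / a * (2 * C + N * (Q / eps)).
have L_ge0 : 0 <= L.
  by rewrite mulr_ge0 ?divr_ge0 ?addr_ge0 ?mulr_ge0 ?invr_ge0// ltW.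
(* delta < 1 serves only to bound x; L + 1 is positive even if all the
   constants vanish. *)
exists (L + 1), 1; split=> [||delta y x /andP[d0 d1] yd minx]; [lra|by []|].
have [Phih gaps] : norm2 (Phi *m (x - x0)) <= C * delta /\
    \sum_(J in JJ) gap J v x <= C * delta.
  by apply: HC minx; rewrite ?Phix0.
have cd0 : 0 < c * delta by exact: mulr_gt0.
have Cd_ge0 : 0 <= C * delta by rewrite mulr_ge0// ltW.
have gapI := HA _ _ _ (minimizer_subdifferential cd0 minx) Cd_ge0 Phih gaps.
set h := x - x0 in Phih gapI *; set t := norm2 h in gapI *.
have t_ge0 : 0 <= t by exact: norm2_ge0.
have xM J : J \in JJ -> norm_on J x <= M.
  move=> JJJ; apply: (@le_trans _ _ (norm12 JJ x)).
    rewrite norm12_blocks (bigD1 J)//= lerDl.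
    by apply: sumr_ge0 => J' _; exact: norm_on_ge0.
  move: gaps; rewrite (sum_gap hJJ vE sv) -/h.
  have : inner u0 (Phi *m h) <= norm2 u0 * (C * delta).
    by apply: le_trans (inner_le _ _) _; rewrite ler_wpM2l// norm2_ge0.
  have Cd : C * delta <= C by rewrite ler_piMr// ltW.
  have : norm2 u0 * (C * delta) <= norm2 u0 * C.
    by rewrite ler_wpM2l// norm2_ge0.
  by rewrite /M; lra.
have tanI J : J \in active JJ x0 ->
    norm_on J (orthogonal_part J v h) <= eps * t + Q / eps * delta.
  move=> JI; have JJJ : J \in JJ by move: JI; rewrite inE => /andP[].
  have r0 : 0 <= Q / eps * delta.
    by apply: mulr_ge0; [exact: divr_ge0 Q_ge0 (ltW eps0)|exact: ltW].
  have l0 : 0 <= eps * t by rewrite mulr_ge0 ?(ltW eps0).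
  rewrite -(@ler_pXn2r _ 2) ?nnegrE ?norm_on_ge0 ?addr_ge0//.
  apply: le_trans (active_orthogonal_part_bound hJJ sv x JI) _.
  apply: (@le_trans _ _ (Q * (t * delta))).
    apply: (@le_trans _ _ (2 * M * (A * t * (C * delta)))).
      rewrite ler_pM ?mulr_ge0 ?norm_on_ge0 ?gap_pos ?gapI//.
      by rewrite ler_wpM2l// xM.
    by rewrite le_eqVlt; apply/predU1P; left; rewrite /Q; ring.
  rewrite sqrrD; have -> : eps * t * (Q / eps * delta) = Q * (t * delta).
    by field; rewrite gt_eqF.
  have : 0 <= Q * (t * delta) by rewrite !mulr_ge0// ltW.
  by have := sqr_ge0 (eps * t); have := sqr_ge0 (Q / eps * delta); lra.
have := Ha h; rewrite -/t => coer.
have tan_sum : \sum_(J in active JJ x0) norm_on J (orthogonal_part J v h) <=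
    a / 2 * t + N * (Q / eps) * delta.
  apply: (@le_trans _ _ (\sum_(J in active JJ x0) (eps * t + Q / eps * delta))).
    exact: ler_sum.
  have Neps : N * eps <= a / 2.
    rewrite /eps mulrA ler_pdivrMr; last by lra.
    by have := ltW a0; nra.
  rewrite sumr_const -[leLHS]mulr_natl -/N.
  have : N * eps * t <= a / 2 * t by rewrite ler_wpM2r.
  lra.
have gap_sum : \sum_(J in inactive JJ x0) gap J v h <= C * delta.
  apply: le_trans gaps; rewrite (big_active_inactive JJ x0).
  rewrite -[leLHS]add0r lerD//.
    apply: sumr_ge0 => J JI; apply: gap_pos.
    by move: JI; rewrite inE => /andP[].
  apply: ler_sum => J JI; rewrite le_eqVlt; apply/predU1P; left.
  have hx i : i \in J -> h i 0 = x i 0.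
    by move=> iJ; rewrite !mxE (inactive_eq0 JI)// subr0.
  by rewrite /gap; congr (Num.sqrt _ - _); exact: eq_dot_on.
have : a * t <= a * (L * delta).
  have -> : a * (L * delta) = 2 * (2 * C + N * (Q / eps)) * delta.
    by rewrite /L; field; rewrite !gt_eqF.
  lra.
rewrite ler_pM2l// => /le_trans; apply; rewrite ler_pM2r//; lra.
Qed.
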